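(* There is a universal constant $C>0$ such that the following holds. Let $n\ge2$, let $x=(x_1,\dots,x_n)$ be an $(M,\gamma)$-Ising model, and fix $\eta\in(0,M]$. Then there exist subsets $I_1,\dots,I_\ell\subseteq[n]$ with $\ell\le CM^2\log n/\eta^2$ such that: 1. For all $i\in[n]$, $|\{j\in[\ell]:i\in I_j\}|=\left\lceil\frac{\eta\ell}{8M}\right\rceil$. 2. For all $j\in[\ell]$ and any value of $x_{-I_j}$, the conditional distribution of $x_{I_j}$ conditioned on $x_{-I_j}$ is an $(\eta,\gamma)$-Ising model. Furthermore, for any non-negative vector $\theta\in\mathbb{R}^n$ there exists $j\in[\ell]$ such that $$\sum_{i\in I_j}\theta_i\ge\frac{\eta}{8M}\sum_{i=1}^n\theta_i.$$
   Context: $[n]=\{1,\dots,n\}$; for $I\subseteq[n]$, $-I=[n]\setminus I$ and $x_I=(x_i)_{i\in I}$. An Ising model with interaction matrix $J$ (real, symmetric, zero diagonal) and external field $h\in\mathbb{R}^n$ is the distribution on $\{\pm1\}^n$ with $\Pr[x]\propto\exp(x^\top Jx/2+h^\top x)$. A random vector $x$ is an $(M,\gamma)$-Ising model ($(M,\gamma)$-bounded) if it follows an Ising model with interaction matrix $J$ and some external field $h$ such that $\|J\|_\infty=\max_i\sum_j|J_{ij}|\le M$ and $\min_i\mathrm{Var}(x_i\mid x_{-i})\ge\gamma$ with probability $1$. Here $M,\gamma>0$. *)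

(* Defs.v *)
From HB Require Import structures.
From mathcomp Require Import all_boot all_order all_algebra.
From mathcomp Require Import all_classical all_reals all_analysis.

Set Implicit Arguments.
Unset Strict Implicit.
Unset Printing Implicit Defensive.

Import Order.TTheory GRing.Theory Num.Theory.

Local Open Scope ring_scope.

(* A point of {+1,-1}^n; [true] encodes +1 and [false] encodes -1. *)
Definition config (n : nat) := {ffun 'I_n -> bool}.

Section IsingModel.
Context {R : realType}.
Implicit Types (n : nat) (M gamma : R).

Definition spin (b : bool) : R := if b then 1 else -1.

Definition spins n (s : config n) : 'cV[R]_n := \col_i spin (s i).

Definition energy n (J : 'M[R]_n) (h : 'cV[R]_n) (s : config n) : R :=
  ((spins s)^T *m J *m spins s) 0 0 / 2 + (h^T *m spins s) 0 0.

Definition ising n (J : 'M[R]_n) (h : 'cV[R]_n) (s : config n) : R :=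
  expR (energy J h s) / \sum_(t : config n) expR (energy J h t).

Definition interaction_matrix n (J : 'M[R]_n) :=
  J^T = J /\ forall i, J i i = 0.

(* The max-row-sum norm; the norm [`|J|] of MathComp-Analysis is instead the
   largest absolute value of an entry. *)
Definition norm_infty n (J : 'M[R]_n) : R :=
  \big[Num.max/0]_(i < n) \sum_(j < n) `|J i j|.

(* Below, [mu] is the probability mass function of a random vector x with
   values in {+1,-1}^n. *)

Definition Pr n (mu : config n -> R) (A : {set config n}) : R :=
  \sum_(s in A) mu s.

Definition cond_exp n (mu : config n -> R) (f : config n -> R)
    (A : {set config n}) : R :=
  (\sum_(s in A) mu s * f s) / Pr mu A.

Definition cond_var n (mu : config n -> R) (f : config n -> R)
    (A : {set config n}) : R :=
  cond_exp mu (fun s => (f s - cond_exp mu f A) ^+ 2) A.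

(* x_I, whose coordinates are listed in increasing order of their index. *)
Definition restr n (I : {set 'I_n}) (s : config n) : config #|I| :=
  [ffun k => s (enum_val k)].

(* The law of x_I conditioned on x_{-I} = z. *)
Definition cond_law n (mu : config n -> R) (I : {set 'I_n})
    (z : config #|~: I|) (y : config #|I|) : R :=
  Pr mu [set s | (restr I s == y) && (restr (~: I) s == z)]
  / Pr mu [set s | restr (~: I) s == z].

(* The value at x = s of the random variable Var(x_i | x_{-i}). *)
Definition site_var n (mu : config n -> R) (i : 'I_n) (s : config n) : R :=
  cond_var mu (fun t => spin (t i))
    [set t | restr (~: [set i]) t == restr (~: [set i]) s].

(* [mu] is the law of an (M, gamma)-Ising model; the variance bound is required
   on the support of [mu], that is, with probability 1. *)
Definition bounded_ising n M gamma (mu : config n -> R) :=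
  (exists (J : 'M[R]_n) (h : 'cV[R]_n),
     [/\ interaction_matrix J, mu =1 ising J h & norm_infty J <= M]) /\
  (forall s, 0 < mu s -> forall i, gamma <= site_var mu i s).

End IsingModel.

(* Main.v *)
Require Import Defs.
From HB Require Import structures.
From mathcomp Require Import all_boot all_order all_algebra.
From mathcomp Require Import all_classical all_reals all_analysis.
From mathcomp Require Import ring lra.

(** The sets I_j can be taken to be the classes of a single partition of the
    sites. Put l = ceil (M / eta) and colour the sites with l colours so as to
    minimize the total weight |J i k| of the monochromatic pairs. Recolouring
    one site i cannot lower this weight, so the weight of the edges from i into
    its own class is at most the weight from i into any other class, hence at
    most the average over all classes, which is at most M / l <= eta
    ([balanced_partition]). Every site lies in exactly one class, and since
    eta <= M we have l <= 2 M / eta, so eta l / (8 M) lies in ]0, 1] and its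
    ceiling is 1. The same bound on l gives
    l <= 2 (M / eta) ^ 2 <= (2 / ln 2) (M / eta) ^ 2 ln n.

    It remains to see what conditioning on the spins outside a set I does to an
    Ising model. The spins outside I enter the energy through a constant and
    through an external field on I ([energy_glue]), so the conditional law is
    the Ising model of the principal submatrix of J on I ([cond_law_ising]),
    whose row sums are the weights from a site into its own class. The variance
    at a site given all the others is the same number in both models: once
    x_{-I} is frozen, conditioning on x_{I \ k} is conditioning on all
    sites but k ([site_var_cond_law]).

    Finally, for nonnegative theta the class sums add up to the sum T of theta,
    so some class has at least T / l >= eta / (8 M) T ([exists_heavy_class]). *)

Set Implicit Arguments.
Unset Strict Implicit.
Unset Printing Implicit Defensive.

Import Order.TTheory GRing.Theory Num.Theory.

Local Open Scope ring_scope.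

(** * Balanced partitions of a weighted graph *)

(** A colouring of minimal monochromatic weight is a local minimum: for each
    vertex, its own class is the lightest one, and so is no heavier than the
    average class. Symmetry of W makes the cost of a vertex proportional to the
    weight it sends into its class. *)
Lemma balanced_partition (R : realDomainType) (T : finType) (k : nat)
    (W : T -> T -> R) :
  (0 < k)%N -> (forall i j, W i j = W j i) -> (forall i, W i i = 0) ->
  exists f : {ffun T -> 'I_k},
    forall i, k%:R * (\sum_(j | f j == f i) W i j) <= \sum_j W i j.
Proof.
case: k => // k _ symW diagW.
pose cost (f : {ffun T -> 'I_k.+1}) := \sum_a \sum_b W a b *+ (f a == f b).
pose f := [arg min_(f < [ffun=> ord0] : {ffun T -> 'I_k.+1}) cost f]%O.
have fmin g : cost f <= cost g by rewrite /f; case: arg_minP => // ? _; apply.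
exists f => i.
pose move c : {ffun T -> 'I_k.+1} := [ffun a => if a == i then c else f a].
pose load c := \sum_b W i b *+ (f b == c).
(* Recolouring i changes only the row and the column of i, which agree. *)
have moveE c : cost (move c) = load c *+ 2
    + \sum_(a | a != i) \sum_(b | b != i) W a b *+ (f a == f b).
  have loadD1 : load c = \sum_(a | a != i) W i a *+ (f a == c).
    by rewrite /load (bigD1 i) //= diagW mul0rn add0r.
  rewrite /cost (bigD1 i) //= (bigD1 i) //= diagW mul0rn add0r.
  rewrite [X in _ + X](eq_bigr (fun a => W i a *+ (f a == c)
     + \sum_(b | b != i) W a b *+ (f a == f b))); last first.
    move=> a /negPf ai; rewrite (bigD1 i) //= symW !ffunE ai eqxx.
    by congr (_ + _); apply: eq_bigr => b /negPf bi; rewrite !ffunE bi.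
  rewrite big_split /= addrA mulr2n loadD1; congr (_ + _ + _).
  by apply: eq_bigr => b /negPf bi; rewrite !ffunE bi eqxx eq_sym.
have move_id : move (f i) = f.
  by apply/ffunP => a; rewrite ffunE; case: eqP => // ->.
have load_min c : load (f i) <= load c.
  by have := fmin (move c); rewrite -{1}move_id !moveE lerD2r lerMn2r.
have -> : \sum_(j | f j == f i) W i j = load (f i).
  by rewrite big_mkcond; apply: eq_bigr => j _; case: eqP.
have -> : \sum_j W i j = \sum_c load c.
  rewrite exchange_big; apply: eq_bigr => b _ /=.
  rewrite (bigD1 (f b)) //= eqxx big1 ?addr0 // => c.
  by rewrite eq_sym => /negPf->.
rewrite mulr_natl -[X in _ *+ X]card_ord -sumr_const.
by apply: ler_sum => c _; apply: load_min.
Qed.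

(** The class sums of theta average to its total divided by k, so the largest one
    is at least that average. *)
Lemma exists_heavy_class (R : realDomainType) (T : finType) (k : nat)
    (f : T -> 'I_k) (theta : T -> R) (a : R) :
  (0 < k)%N -> a * k%:R <= 1 ->
  (forall i, 0 <= theta i) ->
  exists c, a * \sum_i theta i <= \sum_(i | f i == c) theta i.
Proof.
case: k f => // k f _ ak theta_ge0; set S := \sum_i theta i.
have S_ge0 : 0 <= S by apply: sumr_ge0.
apply/existsP; apply: contraT => /existsPn light.
suff : S < S by rewrite ltxx.
rewrite {1}/S (partition_big f xpredT) //=.
apply: (@lt_le_trans _ _ (\sum_(c < k.+1) a * S)).
  apply: ltr_sum => [|c _]; last by rewrite ltNge light.
  by apply/hasP; exists ord0; rewrite ?mem_index_enum.
by rewrite sumr_const card_ord -mulr_natr mulrAC ler_piMl.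
Qed.

(** * Gluing configurations *)

Lemma restr_eqP n (A : {set 'I_n}) (s t : config n) :
  reflect {in A, s =1 t} (restr A s == restr A t).
Proof.
apply: (iffP eqP) => [/ffunP st i iA | st].
  by have := st (enum_rank_in iA i); rewrite !ffunE enum_rankK_in.
by apply/ffunP => k; rewrite !ffunE st // enum_valP.
Qed.

Section Glue.
Context {n : nat} (I : {set 'I_n}).
Implicit Types (y : config #|I|) (z : config #|~: I|) (s t : config n).

(** The value [false] outside of A is never read: [glue] uses [extend] only at
    sites of A. *)
Definition extend (A : {set 'I_n}) (y : config #|A|) (i : 'I_n) : bool :=
  if [pick k : 'I_#|A| | enum_val k == i] is Some k then y k else false.

Lemma extendE (A : {set 'I_n}) (y : config #|A|) k :
  extend y (enum_val k) = y k.
Proof.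
rewrite /extend; case: pickP => [l /eqP/enum_val_inj -> //|/(_ k)].
by rewrite eqxx.
Qed.

(** For fixed z this is the bijection from the configurations on I onto the
    configurations that agree with z off I, inverse to [restr I]. *)
Definition glue y z : config n :=
  [ffun i => if i \in I then extend y i else extend z i].

Lemma glue_in y z k : glue y z (enum_val k) = y k.
Proof. by rewrite ffunE enum_valP extendE. Qed.

Lemma glue_out y z (k : 'I_#|~: I|) : glue y z (enum_val k) = z k.
Proof.
by rewrite ffunE extendE; have := enum_valP k; rewrite inE => /negPf->.
Qed.

Lemma restr_glue y z : restr I (glue y z) = y.
Proof. by apply/ffunP => k; rewrite ffunE glue_in. Qed.

Lemma restrC_glue y z : restr (~: I) (glue y z) = z.
Proof. by apply/ffunP => k; rewrite ffunE glue_out. Qed.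

Lemma glue_restr s : glue (restr I s) (restr (~: I) s) = s.
Proof.
apply/ffunP => i; have [iI|iI] := boolP (i \in I).
  by apply: (restr_eqP _ _ _ _ i iI); rewrite restr_glue.
have iC : i \in ~: I by rewrite inE.
by apply: (restr_eqP _ _ _ _ i iC); rewrite restrC_glue.
Qed.

Lemma glue_inj z : injective (glue^~ z).
Proof. by move=> y y' /(congr1 (restr I)); rewrite !restr_glue. Qed.

Lemma fiber_glue z :
  [set s | restr (~: I) s == z] = [set glue y z | y : config #|I|].
Proof.
apply/setP => s; rewrite inE; apply/eqP/imsetP => [<-|[y _ ->]].
  by exists (restr I s); rewrite ?glue_restr.
exact: restrC_glue.
Qed.

(** Fixing all sites but k after x_{-I} has been fixed to z is fixing all sites
    of the large model but the one numbered k. *)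
Lemma site_fiber_glue y z (k : 'I_#|I|) :
  [set s | restr (~: [set enum_val k]) s
           == restr (~: [set enum_val k]) (glue y z)]
  = [set glue t z | t in [set t | restr (~: [set k]) t
                                  == restr (~: [set k]) y]].
Proof.
apply/setP => s; rewrite inE; apply/idP/imsetP => [/restr_eqP sy|[t + ->]].
  exists (restr I s).
    rewrite inE; apply/restr_eqP => l; rewrite !inE => lk.
    by rewrite ffunE sy ?glue_in // !inE (inj_eq enum_val_inj).
  rewrite -{1}[s]glue_restr; congr glue; apply/ffunP => l.
  rewrite ffunE sy ?glue_out // !inE; apply: contraTneq (enum_valP l) => ->.
  by rewrite inE negbK enum_valP.
rewrite inE => /restr_eqP ty; apply/restr_eqP => i; rewrite !inE !ffunE => ik.
case: ifP => // iI; rewrite -(enum_rankK_in iI iI) !extendE.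
by apply: ty; rewrite !inE; apply: contraNneq ik => <-; rewrite enum_rankK_in.
Qed.

Lemma big_split_enum (R : nmodType) (F : 'I_n -> R) :
  \sum_i F i = \sum_(k < #|I|) F (enum_val k)
             + \sum_(k < #|~: I|) F (enum_val k).
Proof.
rewrite (bigID [in I]) /= (big_enum_val F); congr (_ + _).
rewrite -(big_enum_val F) /=.
by apply: eq_bigl => i; rewrite inE.
Qed.

End Glue.

(** * Conditioning an Ising model *)

Section Conditioning.
Context {R : realType}.

Lemma spinsE n (s : config n) i : spins s i 0 = spin (s i) :> R.
Proof. by rewrite mxE. Qed.

Lemma energyE n (J : 'M[R]_n) (h : 'cV[R]_n) (s : config n) :
  energy J h s = (\sum_i \sum_j spin (s i) * J i j * spin (s j)) / 2
                 + \sum_i h i 0 * spin (s i).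
Proof.
rewrite /energy -mulmxA !mxE; congr (_ / 2 + _).
  apply: eq_bigr => i _; rewrite !mxE mulr_sumr; apply: eq_bigr => j _.
  by rewrite spinsE mulrA.
by apply: eq_bigr => i _; rewrite !mxE.
Qed.

(** The conditioned spins act on the sites of I as an additional field. *)
Definition cond_field n (J : 'M[R]_n) (h : 'cV[R]_n) (I : {set 'I_n})
    (z : config #|~: I|) : 'cV[R]_#|I| :=
  \col_k (h (enum_val k) 0
          + \sum_(l < #|~: I|) J (enum_val k) (enum_val l) * spin (z l)).

Definition principal_mx n (J : 'M[R]_n) (I : {set 'I_n}) : 'M[R]_#|I| :=
  \matrix_(k, l) J (enum_val k) (enum_val l).

(** Split the quadratic form into four blocks along I and its complement: the
    two mixed blocks coincide because J is symmetric, and together they cancel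
    the factor 1/2 and become linear in y; the outer block depends on z only. *)
Lemma energy_glue n (J : 'M[R]_n) (h : 'cV[R]_n) (I : {set 'I_n})
    (z : config #|~: I|) : J^T = J ->
  exists c, forall y : config #|I|,
    energy J h (glue y z)
    = energy (principal_mx J I) (cond_field J h z) y + c.
Proof.
move=> symJ; have JC i j : J i j = J j i by rewrite -{1}symJ mxE.
exists ((\sum_(k < #|~: I|) \sum_(l < #|~: I|)
           spin (z k) * J (enum_val k) (enum_val l) * spin (z l)) / 2
        + \sum_(k < #|~: I|) h (enum_val k) 0 * spin (z k)) => y.
pose B := \sum_(k < #|I|) \sum_(l < #|~: I|)
            spin (y k) * J (enum_val k) (enum_val l) * spin (z l).
have -> : energy (principal_mx J I) (cond_field J h z) y
    = (\sum_k \sum_l spin (y k) * J (enum_val k) (enum_val l) * spin (y l)) / 2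
      + (\sum_k h (enum_val k) 0 * spin (y k) + B).
  rewrite energyE -big_split /=; congr (_ / 2 + _).
    by apply: eq_bigr => k _; apply: eq_bigr => l _; rewrite mxE.
  apply: eq_bigr => k _; rewrite mxE mulrDl mulr_suml; congr (_ + _).
  by apply: eq_bigr => l _; rewrite mulrC mulrA.
have fieldE : \sum_i h i 0 * spin (glue y z i)
    = \sum_(k < #|I|) h (enum_val k) 0 * spin (y k)
      + \sum_(k < #|~: I|) h (enum_val k) 0 * spin (z k).
  rewrite (big_split_enum I); congr (_ + _); apply: eq_bigr => k _.
    by rewrite glue_in.
  by rewrite glue_out.
have rowE i : \sum_j spin (glue y z i) * J i j * spin (glue y z j)
    = \sum_(l < #|I|) spin (glue y z i) * J i (enum_val l) * spin (y l)
      + \sum_(l < #|~: I|) spin (glue y z i) * J i (enum_val l) * spin (z l).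
  rewrite (big_split_enum I); congr (_ + _); apply: eq_bigr => l _.
    by rewrite glue_in.
  by rewrite glue_out.
have crossE : \sum_(k < #|~: I|) \sum_(l < #|I|)
    spin (z k) * J (enum_val k) (enum_val l) * spin (y l) = B.
  rewrite exchange_big; apply: eq_bigr => l _; apply: eq_bigr => k _ /=.
  by rewrite JC; ring.
rewrite energyE fieldE (eq_bigr _ (fun i _ => rowE i)) (big_split_enum I).
under [X in (X + _) / _]eq_bigr do rewrite glue_in.
under [X in (_ + X) / _]eq_bigr do rewrite glue_out.
rewrite !big_split /= crossE -/B; lra.
Qed.

(** Conditional expectations do not see the normalization of a law, so a law nu
    that is proportional to mu along an embedding g has the same ones. *)
Lemma cond_exp_imset (m n : nat) (mu : config n -> R) (nu : config m -> R)
    (g : config m -> config n) (c : R) f (A : {set config m}) :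
  injective g -> c != 0 -> (forall t, mu (g t) = c * nu t) ->
  cond_exp mu f (g @: A) = cond_exp nu (f \o g) A.
Proof.
move=> g_inj c_neq0 mu_g; rewrite /cond_exp /Pr.
rewrite !big_imset /=; [|by move=> ? ? _ _ /g_inj ..].
under eq_bigr do rewrite mu_g -mulrA.
under [X in _ / X = _]eq_bigr do rewrite mu_g.
by rewrite -!mulr_sumr -mulf_div divff // mul1r.
Qed.

Lemma cond_var_imset (m n : nat) (mu : config n -> R) (nu : config m -> R)
    (g : config m -> config n) (c : R) f (A : {set config m}) :
  injective g -> c != 0 -> (forall t, mu (g t) = c * nu t) ->
  cond_var mu f (g @: A) = cond_var nu (f \o g) A.
Proof.
move=> g_inj c_neq0 mu_g.
by rewrite /cond_var !(cond_exp_imset _ _ g_inj c_neq0 mu_g).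
Qed.

Lemma partition_function_gt0 n (J : 'M[R]_n) (h : 'cV[R]_n) :
  0 < \sum_(t : config n) expR (energy J h t).
Proof.
rewrite (bigD1 [ffun=> true]) //= ltr_pwDl ?expR_gt0 // sumr_ge0 //.
Qed.

Lemma ising_gt0 n (J : 'M[R]_n) (h : 'cV[R]_n) s : 0 < ising J h s.
Proof. by rewrite divr_gt0 ?expR_gt0 ?partition_function_gt0. Qed.

Lemma cond_law_glue n (mu : config n -> R) (I : {set 'I_n})
    (z : config #|~: I|) (y : config #|I|) :
  cond_law mu z y = mu (glue y z) / \sum_t mu (glue t z).
Proof.
rewrite /cond_law /Pr; congr (_ / _).
  rewrite (big_pred1 (glue y z)) // => s; rewrite !inE.
  apply/andP/eqP => [[/eqP <- /eqP <-]|->]; first by rewrite glue_restr.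
  by rewrite restr_glue restrC_glue !eqxx.
rewrite fiber_glue big_imset /=; last by move=> ? ? _ _ /glue_inj.
by apply: eq_bigl => t; rewrite inE.
Qed.

(** The constant of [energy_glue] cancels in the normalization. *)
Lemma cond_law_ising n (J : 'M[R]_n) (h : 'cV[R]_n) (I : {set 'I_n})
    (z : config #|~: I|) : J^T = J ->
  cond_law (ising J h) z =1 ising (principal_mx J I) (cond_field J h z).
Proof.
move=> symJ y; have [c energyJ] := energy_glue h z symJ.
set J' := principal_mx J I; set h' := cond_field J h z.
pose a := expR c / \sum_t expR (energy J h t).
have isingE t : ising J h (glue t z) = a * expR (energy J' h' t).
  by rewrite /ising energyJ expRD -mulrA mulrC.
have a_neq0 : a != 0.
  by rewrite gt_eqF // divr_gt0 ?expR_gt0 ?partition_function_gt0.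
rewrite cond_law_glue isingE.
under eq_bigr do rewrite isingE.
by rewrite -mulr_sumr -mulf_div divff // mul1r.
Qed.

Lemma site_var_cond_law n (mu : config n -> R) (I : {set 'I_n})
    (z : config #|~: I|) (k : 'I_#|I|) (y : config #|I|) :
  (forall s, 0 < mu s) ->
  site_var (cond_law mu z) k y = site_var mu (enum_val k) (glue y z).
Proof.
move=> mu_gt0; pose Z := \sum_t mu (glue t z).
have Z_neq0 : Z != 0.
  rewrite gt_eqF // /Z (bigD1 y) //= ltr_pwDl // sumr_ge0 // => t _.
  exact: ltW.
rewrite /site_var site_fiber_glue.
rewrite (cond_var_imset (nu := cond_law mu z) _ _ (glue_inj (z := z)) Z_neq0).
  by congr cond_var; apply/funext => t /=; rewrite glue_in.
by move=> t; rewrite cond_law_glue mulrC divfK.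
Qed.

Lemma row_sum_le_norm_infty n (J : 'M[R]_n) i :
  \sum_j `|J i j| <= norm_infty J.
Proof. exact: (le_bigmax 0 (fun i => \sum_j `|J i j|)). Qed.

Lemma norm_infty_principal_mx n (J : 'M[R]_n) (I : {set 'I_n}) eta :
  0 <= eta -> {in I, forall i, \sum_(j in I) `|J i j| <= eta} ->
  norm_infty (principal_mx J I) <= eta.
Proof.
move=> eta_ge0 rowJ; apply: bigmax_le => // k _.
under eq_bigr do rewrite mxE.
by rewrite -(big_enum_val (fun j => `|J (enum_val k) j|)) rowJ ?enum_valP.
Qed.

Lemma bounded_ising_cond_law n (J : 'M[R]_n) (h : 'cV[R]_n) (I : {set 'I_n})
    gamma eta :
  interaction_matrix J -> 0 <= eta ->
  {in I, forall i, \sum_(j in I) `|J i j| <= eta} ->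
  (forall s i, gamma <= site_var (ising J h) i s) ->
  forall z : config #|~: I|, bounded_ising eta gamma (cond_law (ising J h) z).
Proof.
move=> [symJ diagJ] eta_ge0 rowJ var_ge z; split.
  exists (principal_mx J I), (cond_field J h z); split.
  - split=> [|k]; last by rewrite mxE.
    by apply/matrixP => k l; rewrite !mxE -{1}symJ mxE.
  - exact: cond_law_ising.
  - exact: norm_infty_principal_mx.
move=> y _ k; rewrite site_var_cond_law; first exact: var_ge.
exact: ising_gt0.
Qed.

End Conditioning.

(** * Covering the sites by weakly interacting sets *)

Theorem lemma2 (R : realType) :
  exists C : R, 0 < C /\
    forall (n : nat) (M gamma eta : R) (mu : config n -> R),
      (2 <= n)%N -> 0 < M -> 0 < gamma -> 0 < eta -> eta <= M ->
      bounded_ising M gamma mu ->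
      exists (l : nat) (I : 'I_l -> {set 'I_n}),
        [/\ l%:R <= C * M ^+ 2 * ln (n%:R : R) / eta ^+ 2,
            (forall i : 'I_n,
               #|[set j : 'I_l | i \in I j]|%:Z
               = Num.ceil (eta * l%:R / (8 * M))),
            (forall (j : 'I_l) (z : config #|~: I j|),
               bounded_ising eta gamma (cond_law mu z)) &
            (forall theta : 'cV[R]_n, (forall i, 0 <= theta i 0) ->
               exists j : 'I_l,
                 \sum_(i in I j) theta i 0
                 >= eta / (8 * M) * \sum_(i < n) theta i 0)].
Proof.
have ln2_gt0 : 0 < ln 2 :> R by rewrite ln_gt0 // ltr1n.
exists (2 / ln 2); split; first by rewrite divr_gt0.
move=> n M gamma eta mu n_ge2 M_gt0 gamma_gt0 eta_gt0 eta_le [[J [h]]].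
move=> [intJ /funext -> normJ var_ge].
pose l := `|Num.ceil (M / eta)|%N.
have ratio_ge1 : 1 <= M / eta by rewrite ler_pdivlMr ?mul1r.
have ceil_ge0 : 0 <= Num.ceil (M / eta) by rewrite ceil_ge0; lra.
have lE : l%:R = (Num.ceil (M / eta))%:~R :> R.
  by rewrite -[in RHS](gez0_abs ceil_ge0).
have l_ge : M / eta <= l%:R by rewrite lE; apply: Num.Theory.ceil_ge.
have l_lt : l%:R < M / eta + 1.
  by have := ceilB1_lt (M / eta); rewrite intrD -lE /=; lra.
have l_gt0 : (0 < l)%N by rewrite -(ltr_nat R); lra.
have etal_le : eta * l%:R <= 2 * M.
  rewrite mulrC -ler_pdivlMr // -mulrA; lra.
have M_le : M <= l%:R * eta by rewrite -ler_pdivrMr.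
have [symJ diagJ] := intJ.
have [] := @balanced_partition R 'I_n l (fun i j => `|J i j|) l_gt0.
- by move=> i j; rewrite -{1}symJ mxE.
- by move=> i; rewrite diagJ normr0.
move=> f f_bal.
have classE c (F : 'I_n -> R) :
    \sum_(i in [set i | f i == c]) F i = \sum_(i | f i == c) F i.
  by apply: eq_bigl => i; rewrite inE.
exists l, (fun c => [set i | f i == c]); split.
- have ratio_le : M / eta <= (M / eta) ^+ 2 by rewrite expr2 ler_peMl //; lra.
  have ln_ge : ln 2 <= ln (n%:R : R).
    by rewrite ler_ln ?posrE ?ler_nat ?ltr0n //; apply: leq_trans n_ge2.
  have -> : 2 / ln 2 * M ^+ 2 * ln n%:R / eta ^+ 2
          = 2 * (M / eta) ^+ 2 * (ln n%:R / ln 2) :> R.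
    by field; rewrite !gt_eqF.
  apply: (@le_trans _ _ (2 * (M / eta) ^+ 2)); first by lra.
  by rewrite ler_peMr ?ler_pdivlMr ?mul1r // mulr_ge0 // sqr_ge0.
- move=> i.
  have -> : [set j | i \in [set i | f i == j]] = [set f i].
    by apply/setP => j; rewrite !inE eq_sym.
  rewrite cards1; apply/esym/ceil_def; rewrite subrr.
  by rewrite divr_gt0 ?mulr_gt0 ?ltr0n //= ler_pdivrMr ?mulr_gt0 //; lra.
- move=> c; apply: bounded_ising_cond_law => //; first exact: ltW.
    move=> i; rewrite inE => /eqP fic.
    rewrite -(ler_pM2l (_ : 0 < l%:R)) ?ltr0n //; apply: le_trans M_le.
    apply: le_trans normJ; apply: le_trans (row_sum_le_norm_infty J i).
    by apply: le_trans (f_bal i); rewrite fic classE.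
  by move=> s i; apply: var_ge; apply: ising_gt0.
move=> theta theta_ge0.
have [|c heavy] := exists_heavy_class f (a := eta / (8 * M)) l_gt0 _ theta_ge0.
  by rewrite mulrAC ler_pdivrMr ?mulr_gt0 //; lra.
by exists c; rewrite classE.
Qed.
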